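(* For every formula $\alpha\in\mathcal{ONL}_n^+$: $\models^e\alpha$ (i.e. $(M^e,w)\models\alpha$ for every world $w\in W^e$ of the extended canonical model) if and only if $\mathrm{AX}'\vdash\alpha$.
   Context: Fix a nonempty set $\Phi$ of primitive propositions and a number $n$ of agents $1,\dots,n$. The language $\mathcal{ONL}_n$ is formed from $\Phi$ by closing off under $\neg,\lor$ and unary modalities $L_i,N_i$ ($1\le i\le n$). $\mathcal{ONL}_n^+$ is the extension of $\mathcal{ONL}_n$ by a further unary modal operator $\mathit{Val}$; $\mathit{Sat}(\varphi)$ abbreviates $\neg\mathit{Val}(\neg\varphi)$. A formula is $i$-objective if it is a Boolean combination of primitive propositions and formulas of the form $L_j\varphi$ and $N_j\varphi$ with $j\ne i$ ($\varphi$ arbitrary); it is $i$-subjective if it is a Boolean combination of formulas of the form $L_i\varphi$ and $N_i\varphi$. Axiom system $\mathrm{AX}'$ (formulas range over $\mathcal{ONL}_n^+$, $i$ over agents): A1$_n$: axioms of propositional logic. A2$_n$: $L_i(\alpha\Rightarrow\beta)\Rightarrow(L_i\alpha\Rightarrow L_i\beta)$. A3$_n$: $N_i(\alpha\Rightarrow\beta)\Rightarrow(N_i\alpha\Rightarrow N_i\beta)$. A4$_n$: $\sigma\Rightarrow L_i\sigma\land N_i\sigma$ if $\sigma$ is $i$-subjective. A5$'_n$: $\mathit{Sat}(\neg\alpha)\Rightarrow(N_i\alpha\Rightarrow\neg L_i\alpha)$ if $\alpha$ is $i$-objective. V1: $(\mathit{Val}(\varphi)\land\mathit{Val}(\varphi\Rightarrow\psi))\Rightarrow\mathit{Val}(\psi)$.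 V2: $\mathit{Sat}(\varphi)$ if $\varphi$ is a satisfiable propositional formula. V3: $(\mathit{Sat}(\alpha\land\beta_1)\land\dots\land\mathit{Sat}(\alpha\land\beta_k)\land\mathit{Sat}(\gamma\land\delta_1)\land\dots\land\mathit{Sat}(\gamma\land\delta_m)\land\mathit{Val}(\alpha\lor\gamma))\Rightarrow\mathit{Sat}(L_i\alpha\land\neg L_i\neg\beta_1\land\dots\land\neg L_i\neg\beta_k\land N_i\gamma\land\neg N_i\neg\delta_1\land\dots\land\neg N_i\neg\delta_m)$ if $\alpha,\beta_1,\dots,\beta_k,\gamma,\delta_1,\dots,\delta_m$ are $i$-objective ($k,m\ge 0$). V4: $(\mathit{Sat}(\alpha)\land\mathit{Sat}(\beta))\Rightarrow\mathit{Sat}(\alpha\land\beta)$ if $\alpha$ is $i$-objective and $\beta$ is $i$-subjective. Rules: modus ponens; from $\alpha$ infer $L_i\alpha$ and $N_i\alpha$; from $\varphi$ infer $\mathit{Val}(\varphi)$. ''Consistent'' means consistent with $\mathrm{AX}'$: a finite set is consistent if the negation of its conjunction is not provable; an infinite set is consistent if all its finite subsets are. Extended canonical model $M^e=(W^e,\pi^e,\mathcal K_1^e,\dots,\mathcal K_n^e,\mathcal N_1^e,\dots,\mathcal N_n^e)$: $W^e$ is the set of maximal consistent sets of $\mathcal{ONL}_n^+$ formulas; $\pi^e(w)(p)$ is true iff $p\in w$; $(w,w')\in\mathcal K_i^e$ iff $\{\alpha: L_i\alpha\in w\}\subseteq w'$; $(w,w')\in\mathcal N_i^e$ iff $\{\alpha: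 N_i\alpha\in w\}\subseteq w'$. Satisfaction at $(M^e,w)$: usual clauses for propositions (via $\pi^e$), $\neg$, $\lor$; $(M^e,w)\models L_i\alpha$ iff $(M^e,w')\models\alpha$ for all $w'$ with $(w,w')\in\mathcal K_i^e$; $(M^e,w)\models N_i\alpha$ iff $(M^e,w')\models\alpha$ for all $w'$ with $(w,w')\in\mathcal N_i^e$; $(M^e,w)\models\mathit{Val}(\alpha)$ iff $(M^e,w')\models\alpha$ for all $w'\in W^e$. *)

(* Defs.v *)
From Stdlib Require List.
From mathcomp Require Import all_boot.
From mathcomp Require Import boolp classical_sets.

Set Implicit Arguments.
Unset Strict Implicit.
Unset Printing Implicit Defensive.

Local Open Scope classical_set_scope.

Inductive form (Phi : Type) (n : nat) : Type :=
| Prim of Phi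
| Neg of form Phi n
| Or of form Phi n & form Phi n
| L of 'I_n & form Phi n
| N of 'I_n & form Phi n
| Val of form Phi n.

Arguments Prim {Phi n} _.

Definition And (Phi : Type) (n : nat) (a b : form Phi n) : form Phi n :=
  Neg (Or (Neg a) (Neg b)).
Definition Imp (Phi : Type) (n : nat) (a b : form Phi n) : form Phi n :=
  Or (Neg a) b.
Definition Sat (Phi : Type) (n : nat) (a : form Phi n) : form Phi n :=
  Neg (Val (Neg a)).

Fixpoint objective (Phi : Type) (n : nat) (i : 'I_n) (a : form Phi n) : bool :=
  match a with
  | Prim _ => true
  | Neg b => objective i b
  | Or b c => objective i b && objective i c
  | L j _ => j != i
  | N j _ => j != i
  | Val _ => false
  end.

Fixpoint subjective (Phi : Type) (n : nat) (i : 'I_n) (a : form Phi n) : bool :=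
  match a with
  | Prim _ => false
  | Neg b => subjective i b
  | Or b c => subjective i b && subjective i c
  | L j _ => j == i
  | N j _ => j == i
  | Val _ => false
  end.

Fixpoint propositional (Phi : Type) (n : nat) (a : form Phi n) : bool :=
  match a with
  | Prim _ => true
  | Neg b => propositional b
  | Or b c => propositional b && propositional c
  | L _ _ | N _ _ | Val _ => false
  end.

(* [v] is consulted only at formulas that are not negations or disjunctions,
   so primitive propositions and modal formulas act as propositional atoms. *)
Fixpoint prop_eval (Phi : Type) (n : nat) (v : form Phi n -> bool)
    (a : form Phi n) : bool :=
  match a with
  | Neg b => ~~ prop_eval v b
  | Or b c => prop_eval v b || prop_eval v c
  | _ => v a
  end.

(* substitution instance of a propositional tautology *)
Definition tautology (Phi : Type) (n : nat) (a : form Phi n) : Prop :=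
  forall v : form Phi n -> bool, prop_eval v a.

Definition prop_satisfiable (Phi : Type) (n : nat) (a : form Phi n) : Prop :=
  exists v : Phi -> bool,
    prop_eval (fun b => if b is Prim p then v p else false) a.

(* Sat(a /\ b1) /\ ... /\ Sat(a /\ bk) /\
   Sat(c /\ d1) /\ ... /\ Sat(c /\ dm) /\ Val(a \/ c) *)
Definition V3_premise (Phi : Type) (n : nat) (a : form Phi n)
    (bs : seq (form Phi n)) (c : form Phi n) (ds : seq (form Phi n)) :
    form Phi n :=
  foldr (@And Phi n) (Val (Or a c))
    ([seq Sat (And a b) | b <- bs] ++ [seq Sat (And c d) | d <- ds]).

(* L_i a /\ ~ L_i ~ b1 /\ ... /\ ~ L_i ~ bk /\
   N_i c /\ ~ N_i ~ d1 /\ ... /\ ~ N_i ~ dm *)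
Definition V3_conjunction (Phi : Type) (n : nat) (i : 'I_n) (a : form Phi n)
    (bs : seq (form Phi n)) (c : form Phi n) (ds : seq (form Phi n)) :
    form Phi n :=
  foldl (@And Phi n) (L i a)
    ([seq Neg (L i (Neg b)) | b <- bs] ++
     N i c :: [seq Neg (N i (Neg d)) | d <- ds]).

Inductive provable (Phi : Type) (n : nat) : form Phi n -> Prop :=
| A1 a : tautology a -> provable a
| A2 i a b : provable (Imp (L i (Imp a b)) (Imp (L i a) (L i b)))
| A3 i a b : provable (Imp (N i (Imp a b)) (Imp (N i a) (N i b)))
| A4 i s : subjective i s -> provable (Imp s (And (L i s) (N i s)))
| A5' i a : objective i a ->
    provable (Imp (Sat (Neg a)) (Imp (N i a) (Neg (L i a))))
| V1 a b : provable (Imp (And (Val a) (Val (Imp a b))) (Val b))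
| V2 a : propositional a -> prop_satisfiable a -> provable (Sat a)
| V3 i a bs c ds :
    objective i a -> all (objective i) bs ->
    objective i c -> all (objective i) ds ->
    provable (Imp (V3_premise a bs c ds) (Sat (V3_conjunction i a bs c ds)))
| V4 i a b : objective i a -> subjective i b ->
    provable (Imp (And (Sat a) (Sat b)) (Sat (And a b)))
| MP a b : provable a -> provable (Imp a b) -> provable b
| NecL i a : provable a -> provable (L i a)
| NecN i a : provable a -> provable (N i a)
| NecVal a : provable a -> provable (Val a).

(* The language has no truth constant: the empty conjunction is rendered by
   excluded middle for [p0], a witness that [Phi] is nonempty. *)
Definition conjunction (Phi : Type) (p0 : Phi) (n : nat)
    (s : seq (form Phi n)) : form Phi n :=
  foldr (@And Phi n) (Or (Prim p0) (Neg (Prim p0))) s.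

(* Lists enumerate the finite subsets of [S]; a finite [S] is among its own
   finite subsets, so the finite and infinite cases are treated uniformly. *)
Definition consistent (Phi : Type) (p0 : Phi) (n : nat)
    (S : set (form Phi n)) : Prop :=
  forall s : seq (form Phi n),
    List.Forall S s -> ~ provable (Neg (conjunction p0 s)).

Definition max_consistent (Phi : Type) (p0 : Phi) (n : nat)
    (S : set (form Phi n)) : Prop :=
  consistent p0 S /\
  forall T : set (form Phi n), consistent p0 T -> S `<=` T -> T = S.

Record structure (Phi : Type) (n : nat) := Structure {
  world : Type;
  truth : world -> Phi -> Prop;
  accK : 'I_n -> world -> world -> Prop;
  accN : 'I_n -> world -> world -> Prop
}.

Fixpoint models (Phi : Type) (n : nat) (M : structure Phi n) (w : world M)
    (a : form Phi n) : Prop :=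
  match a with
  | Prim p => truth w p
  | Neg b => ~ models w b
  | Or b c => models w b \/ models w c
  | L i b => forall w' : world M, accK i w w' -> models w' b
  | N i b => forall w' : world M, accN i w w' -> models w' b
  | Val b => forall w' : world M, models w' b
  end.

Definition ext_canonical (Phi : Type) (p0 : Phi) (n : nat) : structure Phi n :=
  {| world := {w : set (form Phi n) | max_consistent p0 w};
     truth := fun w p => sval w (Prim p);
     accK := fun i w w' => [set a | sval w (L i a)] `<=` sval w';
     accN := fun i w w' => [set a | sval w (N i a)] `<=` sval w' |}.

Definition ext_valid (Phi : Type) (p0 : Phi) (n : nat) (a : form Phi n) : Prop :=
  forall w : world (ext_canonical p0 n), models w a.

(* Main.v *)
(* [Val a] is decided outright: [provable a] gives [provable (Val a)], and we
   show that otherwise [provable (Neg (Val a))], i.e. every consistent formula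
   is provably satisfiable; the truth lemma for [Val] is then immediate.  The
   proof is by induction on modal depth.  Given a world [w] omitting [a],
   describe [w] by its literals and, for each agent [i], by which of the
   finitely many formulas [L_i c], [N_i c] it contains, where [L_i], [N_i]
   occur in [a] and [c] is their argument made [i]-objective.  V2, V3 and V4
   make this description satisfiable, the premises of V3 being instances of
   the induction hypothesis (and of A5' for [Val (alpha \/ gamma)]); and any
   world satisfying the description omits [a] as well. *)

Require Import Defs.
From mathcomp Require Import all_boot.
From mathcomp Require Import boolp classical_sets.

Set Implicit Arguments.
Unset Strict Implicit.
Unset Printing Implicit Defensive.

Local Open Scope classical_set_scope.

Ltac truth_table :=
  let v := fresh "v" in
  move=> v /=;
  repeat match goal with
  | |- context [prop_eval v ?a] => case: (prop_eval v a) => //=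
  | |- context [v ?a] => case: (v a) => //=
  end.

Section Worlds.

Variables (Phi : Type) (p0 : Phi) (n : nat).
Implicit Types (a b c d : form Phi n) (s t : seq (form Phi n)).
Implicit Types (S : set (form Phi n)).

(** * Propositional reasoning and the extension of consistent sets to worlds *)

Lemma prop_eval_conjunction (v : form Phi n -> bool) s :
  prop_eval v (conjunction p0 s) = all (prop_eval v) s.
Proof.
elim: s => [|a s IHs] /=; first by rewrite orbN.
by rewrite IHs negb_or !negbK.
Qed.

Lemma provable_taut a b :
  (forall v, prop_eval v a -> prop_eval v b) -> provable a -> provable b.
Proof.
move=> ab pa; apply: (MP pa); apply: A1 => v /=.
by case: (boolP (prop_eval v a)) => // /ab ->.
Qed.

(** Dropping the occurrences of [a] from [t] leaves [s]. The link between the two is stated through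
    valuations, so that A1 can turn it into a derivation. *)
Lemma Forall_setU1 S a t :
  List.Forall (S `|` [set a]) t ->
  exists2 s, List.Forall S s &
    forall v : form Phi n -> bool,
      prop_eval v a -> all (prop_eval v) s -> all (prop_eval v) t.
Proof.
elim: t => [|b t IHt] H; first by exists [::].
have [Sb /IHt [s Ss st]] := (List.Forall_inv H, List.Forall_inv_tail H).
case: Sb => [Sb|/= ->].
- exists (b :: s); first exact: List.Forall_cons.
  by move=> v va /= /andP [-> /st ->].
- by exists s => // v va /st; rewrite /= va => ->.
Qed.

Lemma inconsistent_setU1 S a :
  ~ consistent p0 (S `|` [set a]) ->
  exists2 s, List.Forall S s & provable (Imp (conjunction p0 s) (Neg a)).
Proof.
move=> /existsNP [t /not_implyP [/Forall_setU1 [s Ss st] /contrapT pt]].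
exists s => //; apply: provable_taut pt => v /=.
rewrite !prop_eval_conjunction => nt; rewrite -negb_and; apply: contra nt.
by case/andP => vs va; apply: st.
Qed.

Lemma lindenbaum S :
  consistent p0 S -> exists w : world (ext_canonical p0 n), S `<=` sval w.
Proof.
move=> conS.
(* Zorn is applied to the sets [A] that can be added to [S], not to the consistent supersets of [S],
   so that the empty chain, whose union is empty, is covered by [conS]. *)
have [F FP Ftot|A [conA maxA]] := @Zorn_bigcup _ [set A | consistent p0 (S `|` A)].
  move=> s Fs.
  (* Finitely many elements of the union of a chain already lie in one member of it; the left
     disjunct handles a list that needs no member. *)
  have [Ss|[X FX Xs]] : List.Forall S s \/ exists2 X, F X & List.Forall (S `|` X) s.
    elim: s Fs => [|a s IHs] Fs; first by left.
    have Fa := List.Forall_inv Fs.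
    have {IHs} := IHs (List.Forall_inv_tail Fs).
    have widen X Y : X `<=` Y -> List.Forall (S `|` X) s -> List.Forall (S `|` Y) s.
      by move=> XY; apply: List.Forall_impl => b [|/XY]; [left|right].
    case: Fa => [Sa|[Y FY Ya]].
    - case=> [Ss|[X FX Xs]]; [left|right; exists X => //]; apply: List.Forall_cons => //.
      by left.
    - case=> [Ss|[X FX Xs]]; right.
        exists Y => //; apply: List.Forall_cons; first by right.
        by apply: List.Forall_impl Ss => b; left.
      have [XY|YX] := Ftot _ _ FX FY.
      + exists Y => //; apply: List.Forall_cons; first by right.
        exact: widen Xs.
      + by exists X => //; apply: List.Forall_cons => //; right; apply: YX.
  - exact: conS.
  - exact: (FP _ FX).
suff mA : max_consistent p0 (S `|` A) by exists (exist _ _ mA) => a; left.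
split=> // T conT SAT; apply/seteqP; split=> // a Ta; right.
apply: contrapT => nAa; apply: (maxA T).
  by split=> [b Ab|TA]; [apply: SAT; right|exact/nAa/TA].
rewrite /= (_ : S `|` T = T) //; apply/seteqP; split=> [b [Sb|]//|b]; last by right.
by apply: SAT; left.
Qed.

Definition contains (w : world (ext_canonical p0 n)) a : bool := `[< sval w a >].

Implicit Types (u w : world (ext_canonical p0 n)).

Lemma containsP w a : reflect (sval w a) (contains w a).
Proof. exact: asboolP. Qed.

Lemma contains_Forall w s : List.Forall (sval w) s <-> all (contains w) s.
Proof.
elim: s => [|a s IHs] //=; split=> [H|/andP [/containsP wa /IHs ws]].
- apply/andP; split; first exact/containsP/(List.Forall_inv H).
  exact/IHs/(List.Forall_inv_tail H).
- exact: List.Forall_cons.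
Qed.

(** If [a] could not be added consistently, some finite part [t] of the world would refute [a];
    together with [s], which derives [a], it would be inconsistent. Maximality then puts [a] in the
    world. *)
Lemma contains_derivable w s a :
  all (contains w) s -> provable (Imp (conjunction p0 s) a) -> contains w a.
Proof.
case: w => S mS; move=> /contains_Forall /= Ss psa; apply/containsP => /=.
have [conS maxS] := mS.
have conSa : consistent p0 (S `|` [set a]).
  apply: contrapT => /inconsistent_setU1 [t St pta]; apply: (conS (s ++ t)).
    by apply/List.Forall_app.
  apply: MP pta _; apply: provable_taut psa => v /=.
  rewrite !prop_eval_conjunction all_cat.
  by case: all; case: all; case: prop_eval.
by rewrite -(maxS _ conSa); [right|move=> b; left].
Qed.

Lemma contains_provable w a : provable a -> contains w a.
Proof.
move=> pa; apply: (@contains_derivable w [::]) => //.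
by apply: provable_taut pa => v /= ->; rewrite orbT.
Qed.

Lemma contains_Neg w a : contains w (Neg a) = ~~ contains w a.
Proof.
apply/idP/idP => [wna|].
  apply/negP => wa; have [conw _] := svalP w.
  apply: (conw [:: a; Neg a]).
    by apply/contains_Forall; rewrite /= wa wna.
  by apply: A1; truth_table.
apply: contraR => nwna; have [conw maxw] := svalP w.
have [con|/inconsistent_setU1 [s ws ps]] :=
    pselect (consistent p0 (sval w `|` [set a])).
  by apply/containsP; rewrite -(maxw _ con); [right|move=> b; left].
exfalso; move/negP: nwna; apply.
by apply: contains_derivable ps; apply/contains_Forall.
Qed.

Lemma contains_Or w a b : contains w (Or a b) = contains w a || contains w b.
Proof.
apply/idP/idP => [wab|].
  apply: contraT; rewrite negb_or -!contains_Neg => /andP [wa wb].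
  suff : contains w (Neg (Or a b)) by rewrite contains_Neg wab.
  apply: (@contains_derivable w [:: Neg a; Neg b]); first by rewrite /= wa wb.
  by apply: A1; truth_table.
case/orP => wx.
- by apply: (@contains_derivable w [:: a]); [rewrite /= wx | apply: A1; truth_table].
- by apply: (@contains_derivable w [:: b]); [rewrite /= wx | apply: A1; truth_table].
Qed.

Lemma contains_And w a b : contains w (And a b) = contains w a && contains w b.
Proof. by rewrite contains_Neg contains_Or !contains_Neg negb_or !negbK. Qed.

Lemma contains_Imp w a b : contains w (Imp a b) = (contains w a ==> contains w b).
Proof. by rewrite contains_Or contains_Neg implybE. Qed.

Lemma contains_Sat w a : contains w (Sat a) = ~~ contains w (Val (Neg a)).
Proof. exact: contains_Neg. Qed.

Lemma contains_conjunction w s :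
  contains w (conjunction p0 s) = all (contains w) s.
Proof.
elim: s => [|a s IHs]; first by rewrite contains_Or contains_Neg orbN.
by rewrite contains_And IHs.
Qed.

Lemma contains_foldr_And w a s :
  contains w (foldr (@And Phi n) a s) = all (contains w) s && contains w a.
Proof. by elim: s => //= b s IHs; rewrite contains_And IHs andbA. Qed.

Lemma contains_foldl_And w a s :
  contains w (foldl (@And Phi n) a s) = contains w a && all (contains w) s.
Proof.
by elim: s a => [|b s IHs] a; rewrite /= ?andbT // IHs contains_And andbA.
Qed.

Lemma derivableP S a :
  (forall w, S `<=` sval w -> contains w a) ->
  exists2 s, List.Forall S s & provable (Imp (conjunction p0 s) a).
Proof.
move=> Sa; have : ~ consistent p0 (S `|` [set Neg a]).
  move=> /lindenbaum [w Sw].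
  have /containsP := Sw (Neg a) (or_intror erefl).
  by rewrite contains_Neg Sa // => b Sb; apply: Sw; left.
move=> /inconsistent_setU1 [s Ss ps]; exists s => //.
by apply: provable_taut ps => v /=; rewrite negbK.
Qed.

(** From here on derivations are replaced by arguments about membership in all worlds. It is
    [derivableP] for the empty set of premises. *)
Lemma provableP a : provable a <-> forall w, contains w a.
Proof.
split=> [pa w|wa]; first exact: contains_provable.
have [s ss ps] := @derivableP set0 a (fun w _ => wa w).
case: s ss ps => [_|b s ss]; last by have := List.Forall_inv ss.
by apply: provable_taut => v /=; rewrite orbN.
Qed.

Lemma contains_MP w a b : provable (Imp a b) -> contains w a -> contains w b.
Proof. by move=> /(contains_provable w); rewrite contains_Imp => /implyP. Qed.

Lemma contains_Val w a : provable a -> contains w (Val a).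
Proof. by move=> pa; apply/contains_provable/NecVal. Qed.

Lemma contains_Val_mono w a b :
  (forall u, contains u a -> contains u b) -> contains w (Val a) -> contains w (Val b).
Proof.
move=> ab wa; apply: contains_MP (V1 a b) _; rewrite contains_And wa.
apply: contains_Val; apply/provableP => u; rewrite contains_Imp.
exact/implyP/ab.
Qed.

(** * The two modalities treated uniformly, and accessibility *)

Definition box (k : bool) (i : 'I_n) a : form Phi n := if k then L i a else N i a.

Lemma provable_box k i a : provable a -> provable (box k i a).
Proof. by case: k => pa; [apply: NecL|apply: NecN]. Qed.

Lemma contains_box_Imp w k i a b :
  contains w (box k i (Imp a b)) -> contains w (box k i a) -> contains w (box k i b).
Proof.
have : provable (Imp (box k i (Imp a b)) (Imp (box k i a) (box k i b))).
  by case: k; [apply: A2|apply: A3].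
by move=> /contains_MP H /H; rewrite contains_Imp => /implyP.
Qed.

Definition acc k i w u : Prop := forall a, contains w (box k i a) -> contains u a.

(** If every successor contains [a], then finitely many formulas boxed in [w] derive [a];
    necessitation and A2 or A3 carry that derivation under the box. *)
Lemma contains_box w k i a :
  contains w (box k i a) <-> forall u, acc k i w u -> contains u a.
Proof.
split=> [wa u|H]; first exact.
have [u wu|s ws ps] := @derivableP [set b | contains w (box k i b)] a.
  by apply: H => b wb; apply/containsP/wu.
apply: contains_box_Imp (contains_provable w (provable_box k i ps)) _.
elim: s ws {ps} => [_|b s IHs ws].
  by apply/contains_provable/provable_box/A1 => v /=; rewrite orbN.
have wb := List.Forall_inv ws.
have {}IHs := IHs (List.Forall_inv_tail ws).
apply: contains_box_Imp IHs; apply: contains_box_Imp wb.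
by apply/contains_provable/provable_box/A1; truth_table.
Qed.

(** A4 carries subjective formulas forward along both relations; since their negations are
    subjective too, their absence is carried as well. *)
Lemma acc_subjective w u k i a :
  subjective i a -> acc k i w u -> contains u a = contains w a.
Proof.
move=> sa wu.
have imp b : subjective i b -> contains w b -> contains u b.
  move=> /A4 /contains_MP H /H; rewrite contains_And => /andP [wL wN].
  by apply: wu; case: k.
apply/idP/idP; last exact: imp.
by apply: contraLR; rewrite -!contains_Neg; apply: imp.
Qed.

(** * Modal depth, objective reducts and the induction hypothesis on [Val] *)

Fixpoint depth a : nat :=
  match a with
  | Prim _ => 0
  | Neg b => depth b
  | Or b c => maxn (depth b) (depth c)
  | L _ b | N _ b | Val b => (depth b).+1
  end.

Definition constant (b : bool) : form Phi n :=
  if b then conjunction p0 [::] else Neg (conjunction p0 [::]).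

Lemma contains_constant w (b : bool) : contains w (constant b) = b.
Proof. by case: b; rewrite /constant ?contains_Neg contains_conjunction. Qed.

(* In [w] the [i]-subjective and [Val] atoms of [a] have the same truth value
   at all [i]-successors, so replacing them by constants makes [a]
   [i]-objective without changing its truth value there. *)
Fixpoint reduce i w a : form Phi n :=
  match a with
  | Prim _ => a
  | Neg b => Neg (reduce i w b)
  | Or b c => Or (reduce i w b) (reduce i w c)
  | L j _ | N j _ => if j == i then constant (contains w a) else a
  | Val _ => constant (contains w a)
  end.

Lemma objective_constant i (b : bool) : objective i (constant b).
Proof. by case: b. Qed.

Lemma objective_reduce i w a : objective i (reduce i w a).
Proof.
elim: a => [p|b IHb|b IHb c IHc|j b _|j b _|b _] //=; rewrite ?IHb //.
- by case: ifPn => [_|//]; exact: objective_constant.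
- by case: ifPn => [_|//]; exact: objective_constant.
- exact: objective_constant.
Qed.

Lemma depth_constant (b : bool) : depth (constant b) = 0.
Proof. by case: b. Qed.

Lemma depth_reduce i w a : depth (reduce i w a) <= depth a.
Proof.
elim: a => [p|b IHb|b IHb c IHc|j b _|j b _|b _] //=; rewrite ?depth_constant //.
- by rewrite geq_max !leq_max IHb IHc orbT.
- by case: ifP; rewrite ?depth_constant.
- by case: ifP; rewrite ?depth_constant.
Qed.

Lemma depth_conjunction k s :
  all (fun a => depth a <= k) s -> depth (conjunction p0 s) <= k.
Proof. by elim: s => //= a s IHs /andP [ak /IHs sk]; rewrite geq_max ak. Qed.

Lemma objective_conjunction i s :
  all (objective i) s -> objective i (conjunction p0 s).
Proof. by elim: s => //= a s IHs /andP [-> /IHs]. Qed.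

Definition Val_decided k : Prop :=
  forall a, depth a <= k -> forall w, contains w (Val a) -> provable a.

Lemma Val_decided_eq k a u w :
  Val_decided k -> depth a <= k -> contains u (Val a) = contains w (Val a).
Proof.
move=> dec ak; apply/idP/idP => /(dec _ ak); exact: contains_Val.
Qed.

Lemma contains_Sat_decided k a u w :
  Val_decided k -> depth a <= k -> contains w a -> contains u (Sat a).
Proof.
move=> dec ak wa; rewrite contains_Sat; apply/negP => /(dec (Neg a) ak).
by move=> /provableP /(_ w); rewrite contains_Neg wa.
Qed.

(** The bound [k.+1] suffices because only the argument of a [Val] has to be decided, and its depth
    is one less. *)
Lemma contains_reduce k m i a u w :
  Val_decided k -> depth a <= k.+1 -> acc m i w u ->
  contains u (reduce i w a) = contains u a.
Proof.
move=> dec + wu.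
elim: a => [p|b IHb|b IHb c IHc|j b _|j b _|b _] //= ak.
- by rewrite !contains_Neg IHb.
- by move: ak; rewrite geq_max !contains_Or => /andP [/IHb -> /IHc ->].
- case: ifP => // ji; rewrite contains_constant.
  by rewrite (acc_subjective _ wu).
- case: ifP => // ji; rewrite contains_constant.
  by rewrite (acc_subjective _ wu).
- by rewrite contains_constant (Val_decided_eq w u dec).
Qed.

Lemma contains_box_reduce k m i a w :
  Val_decided k -> depth a <= k.+1 ->
  contains w (box m i (reduce i w a)) = contains w (box m i a).
Proof.
move=> dec ak; apply/idP/idP => /contains_box H; apply/contains_box => u wu.
- by rewrite -(contains_reduce dec ak wu) H.
- by rewrite (contains_reduce dec ak wu) H.
Qed.

(** * The finite data of a world that determine whether it contains a formula *)

Fixpoint prims a : seq Phi :=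
  match a with
  | Prim p => [:: p]
  | Neg b | L _ b | N _ b => prims b
  | Or b c => prims b ++ prims c
  | Val _ => [::]
  end.

(** [m] selects [L] or [N], and the Boolean given to [nseq] counts as 0 or 1 copies. Descending
    below boxes lets agreement pass to their arguments; [Val] contributes nothing, its value being
    the same at all worlds once decided. *)
Fixpoint args m i a : seq (form Phi n) :=
  match a with
  | Prim _ | Val _ => [::]
  | Neg b => args m i b
  | Or b c => args m i b ++ args m i c
  | L j b => nseq (m && (j == i)) b ++ args m i b
  | N j b => nseq (~~ m && (j == i)) b ++ args m i b
  end.

Lemma depth_args m i a : all (fun c => depth c < depth a) (args m i a).
Proof.
elim: a => [p|b IHb|b IHb c IHc|j b IHb|j b IHb|b IHb] //=; rewrite ?all_cat.
- apply/andP; split; [apply: sub_all IHb|apply: sub_all IHc] => d db;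
    by rewrite leq_max db ?orbT.
- rewrite (sub_all _ IHb) ?andbT => [|d db]; last exact: leqW.
  by case: (_ && _); rewrite //= ltnSn.
- rewrite (sub_all _ IHb) ?andbT => [|d db]; last exact: leqW.
  by case: (_ && _); rewrite //= ltnSn.
Qed.

Definition agree w u a : Prop :=
  all (fun p => contains u (Prim p) == contains w (Prim p)) (prims a) /\
  forall m i, all (fun c => contains u (box m i (reduce i w c)) ==
                            contains w (box m i (reduce i w c))) (args m i a).

(** Equality of the reducts has to be proved along with equality of truth values: [agree] speaks of
    reducts taken at [w], whereas the boxes of [u] are governed by reducts taken at [u]. *)
Lemma agree_contains k w u a :
  Val_decided k -> depth a <= k.+1 -> agree w u a ->
  contains u a = contains w a /\ forall i, reduce i u a = reduce i w a.
Proof.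
move=> dec.
have step m j b : depth b <= k -> contains u (box m j (reduce j w b)) ==
    contains w (box m j (reduce j w b)) -> reduce j u b = reduce j w b ->
    contains u (box m j b) = contains w (box m j b).
  move=> /leqW bk /eqP uw eq_uw.
  by rewrite -!(contains_box_reduce _ _ _ dec bk) eq_uw.
elim: a => [p|b IHb|b IHb c IHc|j b IHb|j b IHb|b _] /= ak [].
- by rewrite /= andbT => /eqP ->.
- move=> pb rb; have [eq_b eq_rb] := IHb ak (conj pb rb).
  by rewrite !contains_Neg eq_b; split=> // i; rewrite eq_rb.
- rewrite all_cat => /andP [pb pc] rbc; move: ak; rewrite geq_max => /andP [bk ck].
  have [|eq_b eq_rb] := IHb bk.
    by split=> // m i; have := rbc m i; rewrite all_cat => /andP [].
  have [|eq_c eq_rc] := IHc ck.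
    by split=> // m i; have := rbc m i; rewrite all_cat => /andP [].
  by rewrite !contains_Or eq_b eq_c; split=> // i; rewrite eq_rb eq_rc.
- move=> pb rLb; have [|_ eq_rb] := IHb (leqW ak).
    by split=> // m i; have := rLb m i; rewrite all_cat => /andP [].
  have eq_L : contains u (L j b) = contains w (L j b).
    apply: (step true) => //.
    by have := rLb true j; rewrite all_cat /= eqxx /= => /andP [/andP []].
  by split=> // i; rewrite eq_L.
- move=> pb rNb; have [|_ eq_rb] := IHb (leqW ak).
    by split=> // m i; have := rNb m i; rewrite all_cat => /andP [].
  have eq_N : contains u (N j b) = contains w (N j b).
    apply: (step false) => //.
    by have := rNb false j; rewrite all_cat /= eqxx /= => /andP [/andP []].
  by split=> // i; rewrite eq_N.
- by move=> _ _; rewrite (Val_decided_eq u w dec).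
Qed.

(** * The description of one agent, and its satisfiability by V3 *)

Definition boxed m i w a : seq (form Phi n) :=
  [seq reduce i w c | c <- args m i a & contains w (box m i (reduce i w c))].

(** The negations serve as the betas and deltas of V3, whose conjuncts negate them once more under
    the box. *)
Definition unboxed m i w a : seq (form Phi n) :=
  [seq Neg (reduce i w c) | c <- args m i a & ~~ contains w (box m i (reduce i w c))].

Definition profile i w a : form Phi n :=
  V3_conjunction i (conjunction p0 (boxed true i w a)) (unboxed true i w a)
    (conjunction p0 (boxed false i w a)) (unboxed false i w a).

Lemma objective_boxed m i w a : objective i (conjunction p0 (boxed m i w a)).
Proof.
apply: objective_conjunction; rewrite all_map; elim: [seq _ <- _ | _] => //= c s ->.
by rewrite objective_reduce.
Qed.

Lemma objective_unboxed m i w a : all (objective i) (unboxed m i w a).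
Proof.
rewrite all_map; elim: [seq _ <- _ | _] => //= c s ->.
by rewrite objective_reduce.
Qed.

(** Arguments of boxes are strictly shallower than [a] and reduction adds no depth; this brings the
    premises of V3 within reach of the induction hypothesis. *)
Lemma depth_boxed k m i w a :
  depth a <= k.+1 -> depth (conjunction p0 (boxed m i w a)) <= k.
Proof.
move=> ak; apply: depth_conjunction; rewrite all_map all_filter.
apply: sub_all (depth_args m i a) => c ca /=; apply/implyP => _.
by apply: leq_trans (depth_reduce i w c) _; rewrite -ltnS (leq_trans ca).
Qed.

Lemma contains_box_conjunction u m i s :
  contains u (box m i (conjunction p0 s)) = all (fun c => contains u (box m i c)) s.
Proof.
apply/idP/idP => [/contains_box us|].
  elim: s us => //= c s IHs us; apply/andP; split.
    by apply/contains_box => v /us; rewrite contains_And => /andP [].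
  by apply: IHs => v /us; rewrite contains_And => /andP [].
move=> us; apply/contains_box => v uv; rewrite contains_conjunction.
by apply: sub_all us => c; apply: uv.
Qed.

Lemma contains_boxed m i w a :
  contains w (box m i (conjunction p0 (boxed m i w a))).
Proof.
rewrite contains_box_conjunction all_map all_filter.
by elim: (args m i a) => //= c s ->; rewrite implybb.
Qed.

Lemma contains_box_NegNeg u m i a :
  contains u (box m i (Neg (Neg a))) = contains u (box m i a).
Proof.
by apply/idP/idP => /contains_box H; apply/contains_box => v /H;
  rewrite !contains_Neg negbK.
Qed.

Lemma contains_V3_conjunction u i a bs c ds :
  contains u (V3_conjunction i a bs c ds) =
  [&& contains u (box true i a), all (fun b => ~~ contains u (box true i (Neg b))) bs,
      contains u (box false i c) & all (fun d => ~~ contains u (box false i (Neg d))) ds].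
Proof.
rewrite /V3_conjunction contains_foldl_And all_cat /= !all_map.
congr [&& _, _, _ & _]; apply: eq_all => b /=; exact: contains_Neg.
Qed.

Lemma contains_profile u w i a :
  contains u (profile i w a) ->
  forall m, all (fun c => contains u (box m i (reduce i w c)) ==
                          contains w (box m i (reduce i w c))) (args m i a).
Proof.
rewrite contains_V3_conjunction => uw m.
have {uw} [] : contains u (box m i (conjunction p0 (boxed m i w a))) /\
    all (fun b => ~~ contains u (box m i (Neg b))) (unboxed m i w a).
  by case/and4P: uw; case: m.
rewrite contains_box_conjunction !all_map !all_filter.
elim: (args m i a) => //= c s IHs /andP [c1 s1] /andP [c2 s2].
rewrite IHs // andbT; move: c1 c2; rewrite contains_box_NegNeg.
by case: (contains w _) => /= [-> _|_ /negbTE ->].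
Qed.

Lemma contains_Sat_profile k u w i a :
  Val_decided k -> depth a <= k.+1 -> contains u (Sat (profile i w a)).
Proof.
move=> dec ak.
apply: contains_MP (V3 (objective_boxed _ _ _ _) (objective_unboxed _ _ _ _)
  (objective_boxed _ _ _ _) (objective_unboxed _ _ _ _)) _.
have Sat_unboxed m : all (contains u)
    [seq Sat (And (conjunction p0 (boxed m i w a)) b) | b <- unboxed m i w a].
  rewrite !all_map all_filter; apply: sub_all (depth_args m i a) => c ca /=.
  apply/implyP => /negP nwc.
  (* The successor of [w] that refutes the unboxed reduct contains all the boxed ones, so it
     witnesses this premise of V3. *)
  have [v wv nvc] : exists2 v, acc m i w v & ~~ contains v (reduce i w c).
    apply: contrapT => /forall2NP nv; apply: nwc; apply/contains_box => v wv.
    by have [//|/negP/negbNE] := nv v.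
  apply: (contains_Sat_decided (w := v) u dec).
    rewrite /= geq_max depth_boxed //=.
    by apply: leq_trans (depth_reduce i w c) _; rewrite -ltnS (leq_trans ca).
  by rewrite contains_And contains_Neg nvc andbT; apply/wv/contains_boxed.
rewrite contains_foldr_And all_cat !Sat_unboxed /=.
set b := conjunction p0 _; set c := conjunction p0 _.
(* Were [Or b c] unprovable, its negation would be satisfiable by the induction hypothesis, and A5'
   would keep [w] from containing both [N i (Or b c)] and [L i (Or b c)]. It contains both, having
   [N i c] and [L i b]. *)
apply: contains_Val; apply: contrapT => /provableP /existsNP [v /negP nv].
have : contains w (Sat (Neg (Or b c))).
  apply: (contains_Sat_decided (w := v) w dec); last by rewrite contains_Neg.
  by rewrite /= geq_max !depth_boxed.
have /A5' /contains_MP A5 : objective i (Or b c) by rewrite /= !objective_boxed.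
move=> {}/A5; rewrite !contains_Imp contains_Neg.
have box_bc m d : contains w (box m i d) -> (forall v, contains v d -> contains v (Or b c)) ->
    contains w (box m i (Or b c)).
  by move=> /contains_box wd dbc; apply/contains_box => v' /wd /dbc.
have -> : contains w (N i (Or b c)).
  by apply: (box_bc false c) (contains_boxed _ _ _ _) _ => v' vc; rewrite contains_Or vc orbT.
have -> // : contains w (L i (Or b c)).
by apply: (box_bc true b) (contains_boxed _ _ _ _) _ => v' vb; rewrite contains_Or vb.
Qed.

(** * Joining literals and profiles into one satisfiable diagram *)

Lemma objective_foldl_And j b s :
  objective j (foldl (@And Phi n) b s) = objective j b && all (objective j) s.
Proof. by elim: s b => [|c s IHs] b; rewrite /= ?andbT // IHs andbA. Qed.

Lemma subjective_foldl_And j b s :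
  subjective j (foldl (@And Phi n) b s) = subjective j b && all (subjective j) s.
Proof. by elim: s b => [|c s IHs] b; rewrite /= ?andbT // IHs andbA. Qed.

Lemma objective_profile i j w a : i != j -> objective j (profile i w a).
Proof.
move=> ij; rewrite objective_foldl_And all_cat /= !all_map /= ij /=.
by apply/andP; split; apply/allT => b /=.
Qed.

Lemma subjective_profile i w a : subjective i (profile i w a).
Proof.
rewrite subjective_foldl_And all_cat /= !all_map /= eqxx /=.
by apply/andP; split; apply/allT => b /=.
Qed.

Lemma propositional_satisfiable w a :
  propositional a -> contains w a -> prop_satisfiable a.
Proof.
move=> pa wa; exists (fun p => contains w (Prim p)).
set v := (fun b => _); suff -> : prop_eval v a = contains w a by [].
elim: a pa {wa} => [p|b IHb|b IHb c IHc|||] //=.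
- by move=> /IHb ->; rewrite contains_Neg.
- by move=> /andP [/IHb -> /IHc ->]; rewrite contains_Or.
Qed.

Lemma contains_Sat_propositional u w a :
  propositional a -> contains w a -> contains u (Sat a).
Proof.
by move=> pa wa; apply/contains_provable/V2/(propositional_satisfiable pa wa).
Qed.

Definition literals w a : form Phi n :=
  conjunction p0
    [seq if contains w (Prim p) then Prim p else Neg (Prim p) | p <- prims a].

Lemma propositional_literals w a : propositional (literals w a).
Proof.
rewrite /literals; elim: (prims a) => //= p s.
by case: ifP => /= _ ->.
Qed.

Lemma objective_literals i w a : objective i (literals w a).
Proof.
rewrite /literals; elim: (prims a) => //= p s.
by case: ifP => /= _ ->.
Qed.

Lemma contains_literals u w a :
  contains u (literals w a) =
  all (fun p => contains u (Prim p) == contains w (Prim p)) (prims a).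
Proof.
rewrite contains_conjunction all_map; apply: eq_all => p /=.
by case: ifP; rewrite ?contains_Neg => _; case: contains.
Qed.

Definition diagram w a (s : seq 'I_n) : form Phi n :=
  foldr (fun i d => And d (profile i w a)) (literals w a) s.

Lemma objective_diagram j w a (s : seq 'I_n) : j \notin s -> objective j (diagram w a s).
Proof.
elim: s => [_|i s IHs]; first exact: objective_literals.
by rewrite inE negb_or eq_sym /= => /andP [/objective_profile -> /IHs ->].
Qed.

(** V2 starts with the literals, and each agent is added by one use of V4. Since [s] has no
    repetition, the diagram built so far is objective for the new agent while its profile is
    subjective. *)
Lemma contains_Sat_diagram k u w a (s : seq 'I_n) :
  Val_decided k -> depth a <= k.+1 -> uniq s -> contains u (Sat (diagram w a s)).
Proof.
move=> dec ak; elim: s => [_|i s IHs /= /andP [/objective_diagram oi us]].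
  apply: (@contains_Sat_propositional u w); first exact: propositional_literals.
  by rewrite contains_literals; apply/allT => p /=.
apply: contains_MP (V4 (oi _ _) (subjective_profile i w a)) _.
by rewrite contains_And IHs // (contains_Sat_profile _ _ _ dec).
Qed.

Lemma contains_diagram u w a :
  contains u (diagram w a (enum 'I_n)) -> agree w u a.
Proof.
have H (s : seq 'I_n) : contains u (diagram w a s) -> contains u (literals w a) /\
    forall i, i \in s -> contains u (profile i w a).
  elim: s => [|i s IHs] //=; rewrite contains_And => /andP [/IHs [ul us] ui].
  by split=> // j; rewrite inE => /orP [/eqP ->|/us].
move=> /H [ul up]; split=> [|m i]; first by rewrite -contains_literals.
by apply/contains_profile/up; rewrite mem_enum.
Qed.

(** * Deciding [Val], the truth lemma and completeness *)

Lemma all_Val_decided k : Val_decided k.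
Proof.
elim: k => [|k dec] a ak u ua; apply: contrapT => /provableP /existsNP [w /negP nwa].
(* A formula of depth 0 is propositional, so V2 makes [Neg a] satisfiable, against [Val a]. *)
- have pa : propositional (Neg a).
    move: ak {ua nwa}; elim: a => //= b IHb c IHc.
    by rewrite geq_max => /andP [/IHb -> /IHc ->].
  have := @contains_Sat_propositional u w _ pa.
  rewrite contains_Neg contains_Sat => /(_ nwa) /negP; apply.
  by apply: contains_Val_mono ua => v va; rewrite !contains_Neg negbK.
(* A world satisfying the diagram of [w] omits [a] as [w] does; hence [Val a] would give [Val] of
   the negated diagram, contrary to its satisfiability. *)
- have := contains_Sat_diagram u w dec ak (enum_uniq 'I_n).
  rewrite contains_Sat => /negP; apply; apply: contains_Val_mono ua => v.
  rewrite contains_Neg; apply: contraL => /contains_diagram va.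
  by have [-> _] := agree_contains dec ak va.
Qed.

Lemma models_contains w a : models w a <-> contains w a.
Proof.
(* The inclusion of sets is accessibility as the extended canonical model defines it, for both
   modalities at once. *)
have box_models m i b w' : (forall u, models u b <-> contains u b) ->
    (forall u, [set c | sval w' (box m i c)] `<=` sval u -> models u b) <->
    contains w' (box m i b).
  move=> IHb; rewrite contains_box; split=> H u wu.
    by apply/IHb/H => c /containsP wc; apply/containsP/wu.
  by apply/IHb/H => c /containsP wc; apply/containsP/wu.
elim: a w => [p|b IHb|b IHb c IHc|j b IHb|j b IHb|b IHb] w /=.
- exact: (rwP (containsP _ _)).
- by rewrite contains_Neg IHb; exact: (rwP negP).
- by rewrite contains_Or IHb IHc; exact: (rwP orP).
- exact: (box_models true).
- exact: (box_models false).
- split=> [H|/(all_Val_decided (leqnn (depth b))) /provableP H u]; last exact/IHb.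
  by apply/contains_Val/provableP => u; apply/IHb.
Qed.

End Worlds.

Theorem corollary5p4 (Phi : Type) (p0 : Phi) (n : nat) (alpha : form Phi n) :
  ext_valid p0 alpha <-> provable alpha.
Proof.
rewrite (provableP p0); split=> H w; first exact/models_contains.
by apply/models_contains.
Qed.
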